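(* Let $\mathfrak{U}$ be any family of finite-dimensional unitary groups equipped with bi-invariant submultiplicative norms, let $\Gamma$ be a countable group and let $\Lambda\le\Gamma$ be a coamenable subgroup. If $\Lambda$ is uniformly $\mathfrak{U}$-stable with a linear estimate, then so is $\Gamma$.
   Context: A subgroup $\Lambda\le\Gamma$ is *coamenable* if there is a $\Gamma$-invariant mean on $\Gamma/\Lambda$, i.e. a linear functional $m:\ell^\infty(\Gamma/\Lambda)\to\mathbb{R}$ with $m(1)=1$, $|m(f)|\le\|f\|$ and $m(g\cdot f)=m(f)$ for all $g\in\Gamma$, $f\in\ell^\infty(\Gamma/\Lambda)$. **Stability.** All groups are discrete and countable; $\omega$ is a fixed non-principal ultrafilter on $\mathbb{N}=\{0,1,2,\dots\}$. $\mathfrak{U}$ is a family of pairs $(U(k),\|\cdot\|)$, where $U(k)$ is the group of $k\times k$ unitary matrices and $\|\cdot\|$ is a norm on $k\times k$ complex matrices that is submultiplicative ($\|AB\|\le\|A\|\|B\|$) and bi-invariant ($\|uAv\|=\|A\|$ for $u,v\in U(k)$); the same $U(k)$ may occur several times with different norms. For a group $G$ and maps $\phi,\psi:G\to U(k)$ put $\operatorname{def}(\phi)=\sup_{g,h\in G}\|\phi(gh)-\phi(g)\phi(h)\|$ and $\operatorname{dist}(\phi,\psi)=\sup_{g\in G}\|\phi(g)-\psi(g)\|$. A *uniform asymptotic homomorphism* $\phi:G\to\mathfrak{U}$ is a sequence of maps $\phi_n:G\to U(k_n)$, with $(U(k_n),\|\cdot\|)\in\mathfrak{U}$, such that $\operatorname{def}(\phi_n)\to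 0$. $G$ is *uniformly $\mathfrak{U}$-stable* if for every uniform asymptotic homomorphism $(\phi_n)$ there are homomorphisms $\psi_n:G\to U(k_n)$ with $\operatorname{dist}(\phi_n,\psi_n)\to 0$. It is *uniformly $\mathfrak{U}$-stable with a linear estimate* if for every uniform asymptotic homomorphism $(\phi_n)$ there are homomorphisms $\psi_n:G\to U(k_n)$ with $\operatorname{dist}(\phi_n,\psi_n)=O_\omega(\operatorname{def}(\phi_n))$, i.e. there are $C\ge 0$ and $S\in\omega$ such that $\operatorname{dist}(\phi_n,\psi_n)\le C\operatorname{def}(\phi_n)$ for all $n\in S$. *)

(* Defs.v *)
From HB Require Import structures.
From mathcomp Require Import all_boot all_order all_algebra.
From mathcomp Require Import generic_quotient spectral.
From mathcomp Require Import all_classical all_reals all_analysis.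
From mathcomp Require Import complex.

Set Implicit Arguments.
Unset Strict Implicit.
Unset Printing Implicit Defensive.

Import Order.TTheory GRing.Theory Num.Theory.
Import numFieldNormedType.Exports.
Local Open Scope classical_set_scope.
Local Open Scope ring_scope.
Local Open Scope sesquilinear_scope.
Local Open Scope quotient_scope.

Section Subgroup.
Variables (G : groupType) (H : groupClosed G).

Definition subgroup := {x : G | x \in H}.

HB.instance Definition _ := SubType.on subgroup.
HB.instance Definition _ := Choice.on subgroup.

Fact subgroup_closed : group_closed (mem H).
Proof. by split; [exact: gpred1 | move=> x y xH yH; exact: gpredF]. Qed.

HB.instance Definition _ :=
  SubChoice_isSubGroup.Build G (mem H) subgroup subgroup_closed.

(* x H = y H *)
Definition lcoset_rel : rel G := fun x y => (x^-1 * y)%g \in H.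

Fact lcoset_rel_refl : reflexive lcoset_rel.
Proof. by move=> x; rewrite /lcoset_rel mulVg gpred1. Qed.

Fact lcoset_rel_sym : symmetric lcoset_rel.
Proof.
suff imp x y : lcoset_rel x y -> lcoset_rel y x.
  by move=> x y; apply/idP/idP; exact: imp.
by rewrite /lcoset_rel => /gpredVr; rewrite invgM invgK.
Qed.

Fact lcoset_rel_trans : transitive lcoset_rel.
Proof.
move=> y x z xy yz; rewrite /lcoset_rel.
suff -> : (x^-1 * z = (x^-1 * y) * (y^-1 * z))%g by exact: gpredM.
by rewrite mulgA -[(_ * y * _)%g]mulgA mulgV mulg1.
Qed.

Canonical lcoset_equiv :=
  EquivRel lcoset_rel lcoset_rel_refl lcoset_rel_sym lcoset_rel_trans.

Definition lcosets := {eq_quot lcoset_equiv}.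
HB.instance Definition _ := Choice.on lcosets.
HB.instance Definition _ := EqQuotient.on lcosets.

Definition lcoset_act (g : G) (c : lcosets) : lcosets :=
  \pi_lcosets (g * repr c)%g.

Lemma lcoset_actE (g x : G) :
  lcoset_act g (\pi_lcosets x) = \pi_lcosets (g * x)%g.
Proof.
apply/eqmodP; rewrite /= /lcoset_rel invgM mulgA -[(_ / g * g)%g]mulgA.
rewrite mulVg mulg1.
by have /eqmodP := reprK (\pi_lcosets x).
Qed.

End Subgroup.

Section BoundedFunctions.
Variables (R : realType) (T : Type).

Definition bounded_pred : {pred T -> R^o} :=
  [pred f : T -> R^o | `[< bounded_fun f >]].

Lemma bounded_predP (f : T -> R^o) :
  reflect (exists M, forall x, `|f x| <= M) (f \in bounded_pred).
Proof.
rewrite inE; apply: (iffP (asboolP _)) => [|[M fM]].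
  by move=> /pinfty_ex_gt0[M _ fM]; exists M => x; exact: fM.
exists M; split; first exact: num_real.
by move=> N /ltW MN x _; exact: le_trans (fM x) MN.
Qed.

Fact bounded_pred_submod : subsemimod_closed bounded_pred.
Proof.
split=> [|a f /bounded_predP[M fM]]; first split.
- by apply/bounded_predP; exists 0 => x; rewrite normr0.
- move=> f g /bounded_predP[M fM] /bounded_predP[N gN].
  apply/bounded_predP; exists (M + N) => x.
  exact: le_trans (ler_normD _ _) (lerD (fM x) (gN x)).
- apply/bounded_predP; exists (`|a| * M) => x.
  by rewrite normrZ ler_wpM2l.
Qed.

HB.instance Definition _ :=
  GRing.isSubmodClosed.Build R (T -> R^o) bounded_pred bounded_pred_submod.

Definition linfty := {f : T -> R^o | f \in bounded_pred}.
HB.instance Definition _ := SubType.on linfty.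
HB.instance Definition _ := Choice.on linfty.
HB.instance Definition _ := [SubChoice_isSubLmodule of linfty by <:].

Definition linfty_norm (f : linfty) : R := sup (range (fun x => `|val f x|)).

Fact linfty_comp_subproof (f : linfty) (s : T -> T) :
  (fun x => val f (s x)) \in bounded_pred.
Proof.
by have /bounded_predP[M fM] := valP f; apply/bounded_predP; exists M.
Qed.

Definition linfty_comp (f : linfty) (s : T -> T) : linfty :=
  Sub (fun x => val f (s x)) (linfty_comp_subproof f s).

Fact linfty_one_subproof : (fun=> 1) \in bounded_pred.
Proof. by apply/bounded_predP; exists 1 => x; rewrite normr1. Qed.

Definition linfty_one : linfty := Sub (fun=> 1) linfty_one_subproof.

End BoundedFunctions.

Section Coamenable.
Variables (R : realType) (G : groupType) (H : groupClosed G).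

Definition linfty_act (g : G) (f : linfty R (lcosets H)) :
  linfty R (lcosets H) := linfty_comp f (lcoset_act g^-1%g).

Definition coamenable :=
  exists m : {linear linfty R (lcosets H) -> R^o},
    [/\ m (linfty_one _ _) = 1,
        forall f, `|m f| <= linfty_norm f &
        forall g f, m (linfty_act g f) = m f].

End Coamenable.

Section UnitaryGroup.
Variables (R : realType) (k : nat).

Definition unitary := {A : 'M[R[i]]_k | A \is unitarymx}.
HB.instance Definition _ := SubType.on unitary.
HB.instance Definition _ := Choice.on unitary.

Fact unitary_one_subproof : (1%:M : 'M[R[i]]_k) \is unitarymx.
Proof. by apply/unitarymxP; rewrite trmx1 map_mx1 mulmx1. Qed.

Definition unitary_one : unitary := Sub 1%:M unitary_one_subproof.

Definition unitary_mul (u v : unitary) : unitary :=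
  Sub (val u *m val v) (mul_unitarymx (valP u) (valP v)).

Definition unitary_inv (u : unitary) : unitary :=
  Sub ((val u)^t*) (etrans (trmxC_unitary (val u)) (valP u)).

Fact unitary_mulA : associative unitary_mul.
Proof. by move=> u v w; apply/val_inj/mulmxA. Qed.

Fact unitary_mul1u : left_id unitary_one unitary_mul.
Proof. by move=> u; apply/val_inj/mul1mx. Qed.

Fact unitary_mulu1 : right_id unitary_one unitary_mul.
Proof. by move=> u; apply/val_inj/mulmx1. Qed.

Fact unitary_mulVu : left_inverse unitary_one unitary_inv unitary_mul.
Proof.
move=> u; apply/val_inj => /=.
by rewrite -invmx_unitary ?(valP u)// mulVmx ?unitarymx_unit ?(valP u).
Qed.

Fact unitary_muluV : right_inverse unitary_one unitary_inv unitary_mul.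
Proof. by move=> u; apply/val_inj/unitarymxP/(valP u). Qed.

HB.instance Definition _ := isGroup.Build unitary
  unitary_mulA unitary_mul1u unitary_mulu1 unitary_mulVu unitary_muluV.

End UnitaryGroup.

(* One member of the family: the unitary group in dimension nu_dim together
   with a norm on all complex matrices of that size; normc is the real-valued
   modulus, and nonnegativity of nu_norm follows from nu_normD and nu_normZ. *)
Record normed_unitary (R : realType) := NormedUnitary {
  nu_dim : nat;
  nu_norm : 'M[R[i]]_nu_dim -> R;
  nu_norm_eq0 : forall A, nu_norm A = 0 -> A = 0;
  nu_normD : forall A B, nu_norm (A + B) <= nu_norm A + nu_norm B;
  nu_normZ : forall (c : R[i]) A,
    nu_norm (c *: A) = ComplexField.Normc.normc c * nu_norm A;
  nu_normM : forall A B, nu_norm (A *m B) <= nu_norm A * nu_norm B;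
  nu_norm_unitary : forall u A v, u \is unitarymx -> v \is unitarymx ->
    nu_norm (u *m A *m v) = nu_norm A
}.

Section Stability.
Variables (R : realType) (G : groupType).

Section DefectDistance.
Variable U : normed_unitary R.
Implicit Types phi psi : G -> unitary R (nu_dim U).

(* By bi-invariance both sets of values are bounded by 2 * nu_norm 1%:M, so
   that the real-valued sup is a genuine supremum. *)
Definition defect phi : R :=
  sup (range (fun gh : G * G =>
    nu_norm (val (phi (gh.1 * gh.2)%g)
             - val (phi gh.1) *m val (phi gh.2)))).

Definition udist phi psi : R :=
  sup (range (fun g : G => nu_norm (val (phi g) - val (psi g)))).

End DefectDistance.

Variable UU : set (normed_unitary R).

Definition uniform_asymptotic_hom (U : nat -> normed_unitary R)
    (phi : forall n, G -> unitary R (nu_dim (U n))) :=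
  (forall n, UU (U n)) /\ (fun n => defect (phi n)) @ \oo --> (0 : R).

Definition uniformly_stable_linear (omega : set_system nat) :=
  forall (U : nat -> normed_unitary R)
         (phi : forall n, G -> unitary R (nu_dim (U n))),
    uniform_asymptotic_hom phi ->
    exists psi : forall n, {multiplicative G -> unitary R (nu_dim (U n))},
    exists2 C : R, 0 <= C &
    exists2 S : set nat, omega S &
      forall n, S n -> udist (phi n) (psi n) <= C * defect (phi n).

End Stability.

(* Main.v *)
(* Kazhdan's averaging argument, made iterative. If phi has defect e and psi is a
   homomorphism of Lambda at distance O(e) from the restriction of phi, then
   phi1(s l) = phi(s) psi(l), for s in a transversal of the left cosets, is at
   distance O(e) from phi and satisfies phi1(g l) = phi1(g) psi(l) for all g.
   Hence x |-> phi1(g x) phi1(x)^-1 is a function on Gamma / Lambda; let T(g) be its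
   mean. Then T(g^-1) = T(g)^*, and invariance of the mean makes T(g h) - T(g) T(h)
   the mean of a product of two O(e) terms. So T is unitary and multiplicative up to
   O(e^2), and so is its unitary polar part. For small e this halves the defect at
   distance O(e), and iterating converges to a homomorphism at distance O(e).
   Submultiplicativity and bi-invariance keep all constants independent of the
   dimension and of the norm. *)
From HB Require Import structures.
Require Import Defs.
From mathcomp Require Import all_boot all_order all_algebra.
From mathcomp Require Import generic_quotient spectral.
From mathcomp Require Import all_classical all_reals all_analysis.
From mathcomp Require Import complex ring lra.

Set Implicit Arguments.
Unset Strict Implicit.
Unset Printing Implicit Defensive.

Import Order.TTheory GRing.Theory Num.Theory.
Import numFieldNormedType.Exports.
Local Open Scope classical_set_scope.
Local Open Scope ring_scope.
Local Open Scope sesquilinear_scope.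
Local Open Scope quotient_scope.

Import ComplexField.Normc.

(** * Bi-invariant norms *)

Section NormTheory.
Variables (R : realType) (U : normed_unitary R).
Local Notation C := R[i].
Local Notation k := (nu_dim U).
Local Notation N := (@nu_norm R U).
Implicit Types A B : 'M[C]_k.

Lemma nu_norm0 : N 0 = 0.
Proof. by rewrite -(scale0r (0 : 'M[C]_k)) nu_normZ normc0 mul0r. Qed.

Lemma nu_normN A : N (- A) = N A.
Proof. by rewrite -scaleN1r nu_normZ normcN normc1 mul1r. Qed.

Lemma nu_norm_ge0 A : 0 <= N A.
Proof.
have := nu_normD A (- A); rewrite subrr nu_norm0 nu_normN.
by rewrite -mulr2n pmulrn_lge0.
Qed.

Lemma nu_normB A B : N (A - B) <= N A + N B.
Proof. by rewrite -[N B]nu_normN; exact: nu_normD. Qed.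

Lemma nu_distC A B : N (A - B) = N (B - A).
Proof. by rewrite -opprB nu_normN. Qed.

Lemma nu_dist_tri B A D : N (A - D) <= N (A - B) + N (B - D).
Proof. by rewrite -[A - D](subrKA B); exact: nu_normD. Qed.

Lemma nu_norm_sum (I : Type) (r : seq I) (P : pred I) (F : I -> 'M[C]_k) :
  N (\sum_(i <- r | P i) F i) <= \sum_(i <- r | P i) N (F i).
Proof.
elim/big_ind2 : _ => [|A a B b Aa Bb|//]; first by rewrite nu_norm0.
exact: le_trans (nu_normD _ _) (lerD Aa Bb).
Qed.

Lemma unitarymx1 : (1%:M : 'M[C]_k) \is unitarymx.
Proof. exact: unitary_one_subproof. Qed.

Lemma nu_norm_unitaryl u A : u \is unitarymx -> N (u *m A) = N A.
Proof. by move=> uu; have := nu_norm_unitary A uu unitarymx1; rewrite mulmx1. Qed.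

Lemma nu_norm_unitaryr A u : u \is unitarymx -> N (A *m u) = N A.
Proof. by move=> uu; have := nu_norm_unitary A unitarymx1 uu; rewrite mul1mx. Qed.

Lemma nu_norm_delta_gt0 i j : 0 < N (delta_mx i j).
Proof.
rewrite lt_neqAle nu_norm_ge0 andbT eq_sym.
apply/eqP => /nu_norm_eq0/matrixP/(_ i j).
by rewrite !mxE !eqxx => /eqP; rewrite oner_eq0.
Qed.

Lemma mul_delta_mx_entry A i j :
  delta_mx i i *m A *m delta_mx j j = A i j *: delta_mx i j.
Proof.
apply/matrixP => a b; rewrite !mxE (bigD1 j)//= big1 => [|l lj]; last first.
  by rewrite !mxE (negbTE lj) mulr0.
rewrite addr0 !mxE (bigD1 i)//= big1 => [|l li]; last first.
  by rewrite !mxE (negbTE li) andbF mul0r.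
rewrite !mxE !eqxx/= andbT addr0.
by case: (a == i); case: (b == j); rewrite ?(mul1r, mulr1, mul0r, mulr0).
Qed.

(** Compressing [A] by two diagonal matrix units isolates one entry, and submultiplicativity bounds
    the result. The constant depends on the norm and the dimension; it serves boundedness and
    convergence only and enters no final estimate. *)
Lemma nu_norm_entry : exists2 c : R, 0 <= c &
  forall A i j, normc (A i j) <= c * N A.
Proof.
pose c i j := N (delta_mx i i) * N (delta_mx j j) / N (delta_mx i j).
have c0 i j : 0 <= c i j by rewrite divr_ge0 ?mulr_ge0 ?nu_norm_ge0.
exists (\sum_i \sum_j c i j) => [|A i j].
  by apply: sumr_ge0 => i _; apply: sumr_ge0.
have cA : normc (A i j) <= c i j * N A.
  rewrite /c mulrAC ler_pdivlMr ?nu_norm_delta_gt0//.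
  rewrite -nu_normZ -mul_delta_mx_entry mulrAC.
  apply: le_trans (nu_normM _ _) _.
  by rewrite ler_wpM2r ?nu_norm_ge0// nu_normM.
apply: le_trans cA _; rewrite ler_wpM2r ?nu_norm_ge0//.
rewrite (bigD1 i)//= (bigD1 j)//= -addrA lerDl addr_ge0//.
  exact: sumr_ge0.
by apply: sumr_ge0 => l _; apply: sumr_ge0.
Qed.

Lemma nu_norm_le_entries : exists2 c : R, 0 <= c &
  forall A e, (forall i j, normc (A i j) <= e) -> N A <= c * e.
Proof.
exists (\sum_i \sum_j N (delta_mx i j)) => [|A e Ae].
  by apply: sumr_ge0 => i _; apply: sumr_ge0 => j _; exact: nu_norm_ge0.
rewrite [A in leLHS]matrix_sum_delta; apply: le_trans (nu_norm_sum _ _ _) _.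
rewrite mulr_suml; apply: ler_sum => i _.
apply: le_trans (nu_norm_sum _ _ _) _; rewrite mulr_suml.
apply: ler_sum => j _; rewrite nu_normZ mulrC.
by rewrite ler_wpM2l ?nu_norm_ge0.
Qed.

Lemma diag_unitarymx (w : 'rV[C]_k) :
  (forall i, w 0 i * (w 0 i)^* = 1) -> diag_mx w \is unitarymx.
Proof.
move=> w1; apply/unitarymxP; rewrite tr_diag_mx map_diag_mx mulmx_diag.
rewrite -diag_const_mx; congr diag_mx.
by apply/rowP => i; rewrite !mxE w1.
Qed.

(* A number in [-1, 1] is the average of two unimodular numbers, so a real
   diagonal contraction is the average of two unitary matrices. *)
Lemma nu_norm_diag_contract (r : 'I_k -> R) A : (forall i, `|r i| <= 1) ->
  N (diag_mx (\row_i (r i)%:C%C) *m A) <= N A.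
Proof.
move=> r1; pose w := \row_i (r i +i* Num.sqrt (1 - r i ^+ 2))%C.
have -> : diag_mx (\row_i (r i)%:C%C) =
    2^-1 *: (diag_mx w + diag_mx (map_mx Num.conj w)).
  apply/matrixP => a b; rewrite !mxE.
  case: (a == b); last by rewrite !mulr0n addr0 mulr0.
  rewrite !mulr1n.
  rewrite [_ + _](addcJ (r a +i* Num.sqrt (1 - r a ^+ 2))%C) mulrA.
  by rewrite mulVf ?mul1r// pnatr_eq0.
have w1 i : (w 0 i) * (w 0 i)^* = 1.
  rewrite mxE; have : 0 <= 1 - r i ^+ 2.
    by rewrite subr_ge0 -real_normK ?num_real// expr_le1.
  move=> /sqr_sqrtr s2; apply/eqP; rewrite eq_complex /=.
  by rewrite !mulrN opprK -!expr2 s2 [_ * r i]mulrC addNr addrC subrK !eqxx.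
have w1' i : (map_mx Num.conj w) 0 i * ((map_mx Num.conj w) 0 i)^* = 1.
  by rewrite [map_mx _ _ _ _]mxE conjCK mulrC w1.
rewrite -scalemxAl nu_normZ mulmxDl.
have -> : normc (2^-1 : C) = 2^-1.
  have -> : (2^-1 : C) = (2^-1)%:C%C by rewrite fmorphV rmorph_nat.
  by rewrite /= expr0n addr0 sqrtr_sqr ger0_norm ?invr_ge0.
rewrite ler_pdivrMl// mulr_natl mulr2n; apply: le_trans (nu_normD _ _) _.
by rewrite !nu_norm_unitaryl//; exact: diag_unitarymx.
Qed.

End NormTheory.

(** * Polar decomposition *)

Section Adjoint.
Variable C : numClosedFieldType.

Lemma adjmxM m n p (A : 'M[C]_(m, n)) (B : 'M[C]_(n, p)) :
  (A *m B)^t* = B^t* *m A^t*.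
Proof. by rewrite trmx_mul map_mxM. Qed.

Lemma mulVmx_unitary n (u : 'M[C]_n) : u \is unitarymx -> u^t* *m u = 1%:M.
Proof. by move=> uu; rewrite -invmx_unitary// mulVmx// unitarymx_unit. Qed.

Lemma mulmx_adj_diag_ge0 m n (A : 'M[C]_(m, n)) i : 0 <= (A *m A^t*) i i.
Proof.
by rewrite mxE; apply: sumr_ge0 => j _; rewrite !mxE mul_conjC_ge0.
Qed.

End Adjoint.

Section Polar.
Variables (R : realType) (U : normed_unitary R).
Local Notation C := R[i].
Local Notation k := (nu_dim U).
Local Notation N := (@nu_norm R U).

(** With [A = T T^*], the unitary is the polar part [A^(-1/2) T], computed in an orthonormal
    eigenbasis of [A]. For [s] an eigenvalue of [A^(1/2)], the identity
    [1 - s = (1 + s)^-1 (1 - s^2)] yields the constant 1, whatever the dimension. *)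
Lemma polar_close (T : 'M[C]_k) : N (T *m T^t* - 1%:M) < 1 ->
  exists2 u, u \is unitarymx & N (u - T) <= N (T *m T^t* - 1%:M).
Proof.
set A := T *m T^t*; move=> A1.
have Anormal : A \is normalmx by apply/normalmxP; rewrite /A adjmxM trmxCK.
pose P := spectralmx A; pose d := spectral_diag A; pose Q := P *m T.
have uP : P \is unitarymx := spectral_unitarymx A.
have uP' : P^t* \is unitarymx by rewrite trmxC_unitary.
have PK : P^t* *m P = 1%:M := mulVmx_unitary uP.
have KP : P *m P^t* = 1%:M by apply/unitarymxP.
have AE : A = P^t* *m diag_mx d *m P.
  have /orthomx_spectralP := Anormal.
  by rewrite (invmx_unitary uP).
have QQ : Q *m Q^t* = diag_mx d.
  rewrite /Q adjmxM mulmxA -[P *m T *m _]mulmxA -/A AE !mulmxA KP mul1mx.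
  by rewrite -mulmxA KP mulmx1.
have N1d : N (1%:M - diag_mx d) = N (A - 1%:M).
  rewrite nu_distC AE -(nu_norm_unitary (diag_mx d - 1%:M) uP' uP).
  by rewrite mulmxBr mulmxBl mulmx1 PK.
pose s i := Num.sqrt (complex.Re (d 0 i)).
have d0 i : 0 <= d 0 i.
  by have := mulmx_adj_diag_ge0 Q i; rewrite QQ mxE eqxx mulr1n.
have dE i : d 0 i = (s i ^+ 2)%:C%C.
  have := d0 i; rewrite /s; case: (d 0 i) => a b /=.
  by rewrite lecE/= => /andP[/eqP -> a0]; rewrite sqr_sqrtr.
(* If [s i = 0], multiplication by [1%:M - diag_mx d] fixes [delta_mx i i], so its norm is at least
   1, against the hypothesis. *)
have s0 i : 0 < s i.
  rewrite lt_neqAle sqrtr_ge0 andbT eq_sym; apply/eqP => si0.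
  have : N (delta_mx i i *m (1%:M - diag_mx d)) <=
      N (delta_mx i i) * N (1%:M - diag_mx d).
    exact: nu_normM.
  suff -> : delta_mx i i *m (1%:M - diag_mx d) = delta_mx i i.
    by apply/negP; rewrite -ltNge N1d gtr_pMr// nu_norm_delta_gt0.
  rewrite mulmxBr mulmx1 mul_mx_diag; apply/matrixP => a b; rewrite !mxE.
  have [/andP[_ /eqP ->]|_] := boolP ((a == i) && (b == i)).
    by rewrite dE si0 expr0n mulr0 subr0.
  by rewrite mul0r subr0.
pose S := diag_mx (\row_i (s i)%:C%C) : 'M[C]_k.
pose S' := diag_mx (\row_i ((s i)^-1)%:C%C) : 'M[C]_k.
have SS' : S *m S' = 1%:M.
  rewrite mulmx_diag -diag_const_mx; congr diag_mx; apply/rowP => i.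
  by rewrite !mxE -rmorphM divff// gt_eqF.
have uS : S' *m Q \is unitarymx.
  apply/unitarymxP; rewrite adjmxM tr_diag_mx map_diag_mx mulmxA.
  rewrite -(mulmxA S') QQ !mulmx_diag -diag_const_mx; congr diag_mx.
  apply/rowP => i; rewrite !mxE dE.
  transitivity ((s i)^-1%:C%C * (s i ^+ 2)%:C%C * (s i)^-1%:C%C : C).
    by congr (_ * _); exact: conjc_real.
  by rewrite -!rmorphM expr2 mulrA mulVf ?mul1r ?divff ?gt_eqF.
exists (P^t* *m (S' *m Q)); first exact: mul_unitarymx.
(* Since [Q = S (S' Q)], the unitary [S' Q] factors out on the right, and bi-invariance leaves only
   [1%:M - S]. *)
have -> : P^t* *m (S' *m Q) - T = P^t* *m (1%:M - S) *m (S' *m Q).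
  rewrite -mulmxA mulmxBl mul1mx [S *m _]mulmxA SS' mul1mx mulmxBr.
  by rewrite /Q [P^t* *m (P *m T)]mulmxA PK mul1mx.
rewrite nu_norm_unitary// -N1d.
have -> : 1%:M - S =
    diag_mx (\row_i ((1 + s i)^-1)%:C%C) *m (1%:M - diag_mx d).
  rewrite mulmxBr mulmx1 mulmx_diag -diag_const_mx -!raddfB; congr diag_mx.
  apply/rowP => i; rewrite !mxE dE -[1]/(1%:C%C) -rmorphM -!rmorphB /=.
  congr (_%:C)%C; have := s0 i => si; field.
  by rewrite gt_eqF// ltr_wpDl.
apply: nu_norm_diag_contract => i.
have s1 : 1 <= 1 + s i by rewrite lerDl ltW.
by rewrite ger0_norm ?invr_ge0 ?(le_trans ler01)// invf_le1 ?(lt_le_trans ltr01).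
Qed.

End Polar.

(** * Means of bounded functions *)

Section Mean.
Variables (R : realType) (X : Type) (x0 : X).
Variable m : {linear linfty R X -> R^o}.
Hypothesis m1 : m (linfty_one R X) = 1.
Hypothesis m_le : forall f, `|m f| <= linfty_norm f.
Local Notation C := R[i].
Implicit Types (f g : X -> R) (F : X -> C).

Definition rbounded f := exists M, forall x, `|f x| <= M.

(* Junk value: the mean of an unbounded function is 0. *)
Definition mean f : R := m (insubd (0 : linfty R X) (f : X -> R^o)).

Lemma val_insubd_rbounded f : rbounded f ->
  val (insubd (0 : linfty R X) (f : X -> R^o)) = f.
Proof. by move=> bf; rewrite insubdK//; apply/bounded_predP. Qed.

Lemma rboundedD f g : rbounded f -> rbounded g -> rbounded (fun x => f x + g x).
Proof.
move=> [M fM] [M' gM]; exists (M + M') => x.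
exact: le_trans (ler_normD _ _) (lerD (fM x) (gM x)).
Qed.

Lemma rboundedZ a f : rbounded f -> rbounded (fun x => a * f x).
Proof. by move=> [M fM]; exists (`|a| * M) => x; rewrite normrM ler_wpM2l. Qed.

Lemma rbounded_cst a : rbounded (fun=> a).
Proof. by exists `|a|. Qed.

Lemma meanD f g : rbounded f -> rbounded g ->
  mean (fun x => f x + g x) = mean f + mean g.
Proof.
move=> bf bg; rewrite /mean -linearD; congr (m _); apply: val_inj.
by rewrite GRing.valD !val_insubd_rbounded//; exact: rboundedD.
Qed.

Lemma meanZ a f : rbounded f -> mean (fun x => a * f x) = a * mean f.
Proof.
move=> bf; rewrite /mean -[_ * _]/(a *: m _) -linearZ; congr (m _).
apply: val_inj; rewrite GRing.valZ !val_insubd_rbounded//; exact: rboundedZ.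
Qed.

Lemma mean_le f b : (forall x, `|f x| <= b) -> `|mean f| <= b.
Proof.
move=> fb; apply: le_trans (m_le _) _; rewrite /linfty_norm.
rewrite val_insubd_rbounded; last by exists b.
by apply: ge_sup => [|_ [x _ <-]//]; exists `|f x0|, x0.
Qed.

Lemma mean1 : mean (fun=> 1) = 1.
Proof.
rewrite -[RHS]m1 /mean; congr (m _); apply: val_inj.
by apply: val_insubd_rbounded; exact: rbounded_cst.
Qed.

Lemma mean_cst a : mean (fun=> a) = a.
Proof.
by have := meanZ a (rbounded_cst 1); rewrite mean1 !mulr1.
Qed.

(** Positivity comes from contractivity: [0 <= f <= M] gives [|M - f| <= M], hence
    [M - mean f <= M]. *)
Lemma mean_ge0 f : rbounded f -> (forall x, 0 <= f x) -> 0 <= mean f.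
Proof.
move=> bf f0; have [M fM] := bf.
have : `|mean (fun x => M + (-1) * f x)| <= M.
  apply: mean_le => x; have := fM x; rewrite (ger0_norm (f0 x)) => fx.
  by rewrite mulN1r ger0_norm ?subr_ge0// lerBlDr lerDl.
rewrite meanD; [|exact: rbounded_cst|exact: rboundedZ]; rewrite mean_cst meanZ//.
by move=> /(le_trans (ler_norm _)); rewrite mulN1r lerBlDr lerDl.
Qed.

Definition cbounded F :=
  rbounded (fun x => complex.Re (F x)) /\ rbounded (fun x => complex.Im (F x)).

Definition cmean F : C :=
  (mean (fun x => complex.Re (F x)) +i* mean (fun x => complex.Im (F x)))%C.

Lemma complex_ReD (z w : C) : complex.Re (z + w) = complex.Re z + complex.Re w.
Proof. by case: z w => [a b] [c d]. Qed.

Lemma complex_ImD (z w : C) : complex.Im (z + w) = complex.Im z + complex.Im w.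
Proof. by case: z w => [a b] [c d]. Qed.

Lemma cmeanE F G H : (forall x, complex.Re (F x) = G x) ->
  (forall x, complex.Im (F x) = H x) -> cmean F = (mean G +i* mean H)%C.
Proof. by move=> /funext FG /funext FH; rewrite /cmean FG FH. Qed.

Lemma cboundedD F G : cbounded F -> cbounded G -> cbounded (fun x => F x + G x).
Proof.
move=> [rF iF] [rG iG]; split.
  by rewrite (funext (fun x => complex_ReD (F x) (G x))); exact: rboundedD.
by rewrite (funext (fun x => complex_ImD (F x) (G x))); exact: rboundedD.
Qed.

Lemma cmeanD F G : cbounded F -> cbounded G ->
  cmean (fun x => F x + G x) = cmean F + cmean G.
Proof.
move=> [rF iF] [rG iG]; rewrite (cmeanE (fun x => complex_ReD (F x) (G x))
  (fun x => complex_ImD (F x) (G x))).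
by rewrite !meanD.
Qed.

Lemma complex_ReM (z w : C) : complex.Re (z * w) =
  complex.Re z * complex.Re w + (- complex.Im z) * complex.Im w.
Proof. by case: z w => [a b] [c d] /=; rewrite mulNr. Qed.

Lemma complex_ImM (z w : C) : complex.Im (z * w) =
  complex.Re z * complex.Im w + complex.Im z * complex.Re w.
Proof. by case: z w => [a b] [c d]. Qed.

Lemma cboundedZ z F : cbounded F -> cbounded (fun x => z * F x).
Proof.
move=> [rF iF]; split.
  rewrite (funext (fun x => complex_ReM z (F x))).
  by apply: rboundedD; exact: rboundedZ.
rewrite (funext (fun x => complex_ImM z (F x))).
by apply: rboundedD; exact: rboundedZ.
Qed.

Lemma cmeanZ z F : cbounded F -> cmean (fun x => z * F x) = z * cmean F.
Proof.
move=> [rF iF]; rewrite (cmeanE (fun x => complex_ReM z (F x))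
  (fun x => complex_ImM z (F x))) !meanD ?meanZ//; try exact: rboundedZ.
by case: z => a b; rewrite /cmean /= mulNr.
Qed.

Lemma cbounded_cst z : cbounded (fun=> z).
Proof. by split; exact: rbounded_cst. Qed.

Lemma cmean_cst z : cmean (fun=> z) = z.
Proof. by rewrite /cmean !mean_cst; case: z. Qed.

Lemma cmean_real f : cmean (fun x => (f x)%:C%C) = (mean f)%:C%C.
Proof. by rewrite /cmean /= mean_cst. Qed.

Lemma cmean_conj F : cbounded F -> cmean (fun x => (F x)^*) = (cmean F)^*.
Proof.
move=> [rF iF].
rewrite (@cmeanE _ (fun x => complex.Re (F x)) (fun x => -1 * complex.Im (F x))).
- by rewrite meanZ// mulN1r.
- by move=> x; case: (F x).
- by move=> x; rewrite mulN1r; case: (F x).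
Qed.

(** Both claims go through one induction, since additivity of [cmean] is available for bounded
    functions only. *)
Lemma cmean_sum (I : Type) (r : seq I) (F : I -> X -> C) :
  (forall i, cbounded (F i)) ->
  cbounded (fun x => \sum_(i <- r) F i x) /\
  cmean (fun x => \sum_(i <- r) F i x) = \sum_(i <- r) cmean (F i).
Proof.
move=> bF; elim: r => [|i r [bS IH]].
  have -> : (fun x => \sum_(i <- [::]) F i x) = fun=> 0.
    by apply/funext => x; rewrite big_nil.
  by rewrite big_nil cmean_cst; split=> //; exact: cbounded_cst.
have -> : (fun x => \sum_(j <- i :: r) F j x) =
    fun x => F i x + \sum_(j <- r) F j x.
  by apply/funext => x; rewrite big_cons.
by rewrite big_cons cmeanD// IH; split=> //; exact: cboundedD.
Qed.

Lemma Re_le_normc (z : C) : `|complex.Re z| <= normc z.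
Proof.
case: z => a b /=; rewrite -sqrtr_sqr; apply: ler_wsqrtr.
by rewrite lerDl sqr_ge0.
Qed.

Lemma Im_le_normc (z : C) : `|complex.Im z| <= normc z.
Proof.
case: z => a b /=; rewrite -sqrtr_sqr; apply: ler_wsqrtr.
by rewrite lerDr sqr_ge0.
Qed.

Lemma normc_le_ReIm (z : C) :
  normc z <= `|complex.Re z| + `|complex.Im z|.
Proof.
have -> : z = (complex.Re z)%:C%C + (0 +i* complex.Im z)%C.
  by case: z => a b; rewrite -[_ + _]/(Complex _ _) addr0 add0r.
apply: le_trans (le_normcD _ _) _.
by rewrite /= !expr0n /= !addr0 !add0r !sqrtr_sqr.
Qed.

End Mean.

(** * Means of matrix-valued functions *)

Section MatrixMean.
Variables (R : realType) (X : Type) (x0 : X).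
Variable m : {linear linfty R X -> R^o}.
Hypothesis m1 : m (linfty_one R X) = 1.
Hypothesis m_le : forall f, `|m f| <= linfty_norm f.
Variable U : normed_unitary R.
Local Notation C := R[i].
Local Notation k := (nu_dim U).
Local Notation N := (@nu_norm R U).
Implicit Types F G : X -> 'M[C]_k.

Definition nbounded F := exists M, forall x, N (F x) <= M.

Definition mxmean F : 'M[C]_k := \matrix_(i, j) cmean m (fun x => F x i j).

Lemma nbounded_entry F i j : nbounded F -> cbounded (fun x => F x i j).
Proof.
move=> [M FM]; have [c c0 cE] := nu_norm_entry U.
have FE x : normc (F x i j) <= c * M.
  by apply: le_trans (cE _ _ _) _; rewrite ler_wpM2l.
split; exists (c * M) => x; apply: le_trans (FE x).
  exact: Re_le_normc.
exact: Im_le_normc.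
Qed.

Lemma nboundedD F G : nbounded F -> nbounded G -> nbounded (fun x => F x + G x).
Proof.
move=> [M FM] [M' GM]; exists (M + M') => x.
exact: le_trans (nu_normD _ _) (lerD (FM x) (GM x)).
Qed.

Lemma nboundedMl A F : nbounded F -> nbounded (fun x => A *m F x).
Proof.
move=> [M FM]; exists (N A * M) => x; apply: le_trans (nu_normM _ _) _.
by rewrite ler_wpM2l// nu_norm_ge0.
Qed.

Lemma nboundedMr F A : nbounded F -> nbounded (fun x => F x *m A).
Proof.
move=> [M FM]; exists (M * N A) => x; apply: le_trans (nu_normM _ _) _.
by rewrite ler_wpM2r// nu_norm_ge0.
Qed.

Lemma nbounded_cst A : nbounded (fun=> A).
Proof. by exists (N A). Qed.

Lemma nbounded_unitary F : (forall x, F x \is unitarymx) -> nbounded F.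
Proof.
by move=> uF; exists (N 1%:M) => x; rewrite -[F x]mulmx1 nu_norm_unitaryl.
Qed.

Lemma mxmeanD F G : nbounded F -> nbounded G ->
  mxmean (fun x => F x + G x) = mxmean F + mxmean G.
Proof.
move=> bF bG; apply/matrixP => i j; rewrite !mxE -cmeanD; try exact: nbounded_entry.
by congr cmean; apply/funext => x; rewrite mxE.
Qed.

Lemma mxmeanMl A F : nbounded F -> mxmean (fun x => A *m F x) = A *m mxmean F.
Proof.
move=> bF; apply/matrixP => i j; rewrite !mxE.
have -> : (fun x => (A *m F x) i j) = fun x => \sum_l A i l * F x l j.
  by apply/funext => x; rewrite mxE.
rewrite (cmean_sum m1 _ _).2 => [|l]; last exact/cboundedZ/nbounded_entry.
by apply: eq_bigr => l _; rewrite cmeanZ ?mxE//; exact: nbounded_entry.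
Qed.

Lemma mxmeanMr F A : nbounded F -> mxmean (fun x => F x *m A) = mxmean F *m A.
Proof.
move=> bF; apply/matrixP => i j; rewrite !mxE.
have -> : (fun x => (F x *m A) i j) = fun x => \sum_l A l j * F x i l.
  by apply/funext => x; rewrite mxE; apply: eq_bigr => l _; rewrite mulrC.
rewrite (cmean_sum m1 _ _).2 => [|l]; last exact/cboundedZ/nbounded_entry.
by apply: eq_bigr => l _; rewrite cmeanZ ?mxE 1?mulrC//; exact: nbounded_entry.
Qed.

Lemma mxmean_cst A : mxmean (fun=> A) = A.
Proof. by apply/matrixP => i j; rewrite mxE cmean_cst. Qed.

Lemma mxmeanB F G : nbounded F -> nbounded G ->
  mxmean (fun x => F x - G x) = mxmean F - mxmean G.
Proof.
move=> bF bG; have NE A : - A = (-1)%:M *m A :> 'M[C]_k.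
  by rewrite mul_scalar_mx scaleN1r.
under eq_fun do rewrite [- G _]NE.
by rewrite mxmeanD ?mxmeanMl//; [rewrite -NE|exact: nboundedMl].
Qed.

Lemma mxmean_adj F : nbounded F ->
  mxmean (fun x => (F x)^t*) = (mxmean F)^t*.
Proof.
move=> bF; apply/matrixP => i j; rewrite !mxE -cmean_conj; last exact: nbounded_entry.
by congr cmean; apply/funext => x; rewrite !mxE.
Qed.

Lemma mxmean_comp F (s : X -> X) :
  (forall f : linfty R X, m (linfty_comp f s) = m f) ->
  nbounded F -> mxmean (fun x => F (s x)) = mxmean F.
Proof.
move=> ms bF; apply/matrixP => i j; rewrite !mxE.
have mean_s f : rbounded f -> mean m (fun x => f (s x)) = mean m f.
  move=> bf; rewrite /mean -[RHS]ms; congr (m _); apply: val_inj => /=.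
  rewrite !val_insubd_rbounded//; have [M fM] := bf.
  by exists M => x; exact: fM.
have [rF iF] := nbounded_entry i j bF.
by rewrite /cmean (mean_s _ rF) (mean_s _ iF).
Qed.

(** The real and imaginary parts of all entries lie in one interval [[-B, B]], which is cut into
    cells of length [d = e / 2]; [q x] records the cells of all entries of [F x]. *)
Lemma quantize F (e : R) : nbounded F -> 0 < e ->
  exists (Q : finType) (q : X -> Q),
    forall x y, q x = q y -> forall i j, normc (F x i j - F y i j) <= e.
Proof.
move=> [M FM] e0; have [c c0 cE] := nu_norm_entry U.
have [d d0 ->] : exists2 d, 0 < d & e = d + d.
  by exists (e / 2); [rewrite divr_gt0|exact: splitr].
pose B := c * M; have FB x i j : normc (F x i j) <= B.
  by apply: le_trans (cE _ _ _) _; rewrite ler_wpM2l.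
pose n := Num.truncn ((B + B) / d).
(* The endpoint [B] falls into cell [n], so [inord] does not overflow on [[-B, B]]. *)
pose z (t : R) : 'I_n.+1 := inord (Num.truncn ((t + B) / d)).
have zP s t : `|s| <= B -> `|t| <= B -> z s = z t -> `|s - t| <= d.
  rewrite !ler_norml => /andP[Bs sB] /andP[Bt tB].
  move=> /(congr1 (@nat_of_ord n.+1)); rewrite /z !inordK ?ltnS; try by
    apply: le_truncn; rewrite ler_pM2r ?invr_gt0// lerD2r.
  move=> st.
  have ge0 u : - B <= u -> 0 <= (u + B) / d.
    by move=> Bu; apply: divr_ge0; [rewrite -lerBlDr sub0r|exact: ltW].
  have /andP[s1 s2] := truncn_itv (ge0 _ Bs).
  have /andP[t1 t2] := truncn_itv (ge0 _ Bt).
  move: s1 s2 t1 t2; rewrite st; set r := Num.truncn _.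
  rewrite !ler_pdivlMr// !ltr_pdivrMr// -natr1.
  by move: (r%:R) => v s1 s2 t1 t2; apply/andP; split; lra.
exists {ffun 'I_k * 'I_k -> 'I_n.+1 * 'I_n.+1}.
exists (fun x => [ffun ij => (z (complex.Re (F x ij.1 ij.2)),
                             z (complex.Im (F x ij.1 ij.2)))]) => x y /ffunP qxy i j.
have := qxy (i, j); rewrite !ffunE /= => -[/zP qr /zP qi].
apply: le_trans (normc_le_ReIm _) _; apply: lerD.
  have -> : complex.Re (F x i j - F y i j) = complex.Re (F x i j) - complex.Re (F y i j).
    by case: (F x i j) (F y i j) => [? ?] [? ?].
  by apply: qr; exact: le_trans (Re_le_normc _) (FB _ _ _).
have -> : complex.Im (F x i j - F y i j) = complex.Im (F x i j) - complex.Im (F y i j).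
  by case: (F x i j) (F y i j) => [? ?] [? ?].
by apply: qi; exact: le_trans (Im_le_normc _) (FB _ _ _).
Qed.

(* Quantizing the entries of F approximates the mean by convex combinations of
   values of F. *)
Lemma mxmean_norm F b : (forall x, N (F x) <= b) -> N (mxmean F) <= b.
Proof.
move=> Fb; have bF : nbounded F by exists b.
have [c c0 cE] := nu_norm_le_entries U.
(* The constant [c] depends on the dimension, but it disappears as [e] tends to 0. *)
suff approx e : 0 < e -> N (mxmean F) <= b + c * e.
  apply/ler_addgt0Pr => e e0; have c1 : 0 < c + 1 by rewrite ltr_wpDl.
  have := approx _ (divr_gt0 e0 c1) => /le_trans; apply.
  rewrite lerD2l mulrCA ger_pMr// ler_pdivrMr// mul1r lerDl//.
move=> e0; have e2 : 0 < e / 2 by rewrite divr_gt0.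
have [Q [q qP]] := quantize bF e2.
(* One sample point per cell; an empty cell receives [x0]. *)
have /choice[rep repP] (d : Q) : exists y, forall x, q x = d -> q y = d.
  have [[y qy]|nq] := pselect (exists y, q y = d); first by exists y.
  by exists x0 => x qx; case: nq; exists x.
pose G x := F (rep (q x)).
pose h d x : R := (q x == d)%:R.
have bh d : rbounded (h d).
  by exists 1 => x; rewrite /h; case: eqP => _; rewrite ?normr1 ?normr0.
have bG : nbounded G by exists b => x; exact: Fb.
(* The weight of a cell is the mean of its indicator. The weights are nonnegative with sum 1, so the
   mean of the step function [G] is a convex combination of values of [F]. *)
pose w d := mean m (h d).
have w0 d : 0 <= w d by apply: mean_ge0 => // x; rewrite /h ler0n.
have hC d : cbounded (fun x => (h d x)%:C%C).
  by split; [exact: bh|exists 0 => x; rewrite normr0].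
have cmh d : cmean m (fun x => (h d x)%:C%C) = (w d)%:C%C by exact: cmean_real.
have sum1 x (f : Q -> C) : \sum_d f d * (h d x)%:C%C = f (q x).
  rewrite (bigD1 (q x))//= big1 => [|d dq]; last first.
    by rewrite /h eq_sym (negbTE dq) mulr0.
  by rewrite /h eqxx mulr1 addr0.
have GE : mxmean G = \sum_d (w d)%:C%C *: F (rep d).
  apply/matrixP => i j; rewrite mxE summxE.
  have -> : (fun x => G x i j) = fun x => \sum_d F (rep d) i j * (h d x)%:C%C.
    by apply/funext => x; rewrite sum1.
  rewrite (cmean_sum m1 _ _).2 => [|d]; last exact: cboundedZ.
  by apply: eq_bigr => d _; rewrite cmeanZ// cmh mxE mulrC.
have W1 : \sum_d w d = 1.
  apply: (@complexI R); rewrite rmorph_sum /=.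
  under eq_bigr do rewrite -cmh.
  rewrite -(cmean_sum m1 _ hC).2; transitivity (cmean m (fun=> 1)).
    congr cmean; apply/funext => x; have := sum1 x (fun=> 1) => <-.
    by apply: eq_bigr => d _; rewrite mul1r.
  exact: cmean_cst.
have Gb : N (mxmean G) <= b.
  rewrite GE; apply: le_trans (nu_norm_sum _ _ _) _.
  rewrite -[leRHS]mul1r -W1 mulr_suml; apply: ler_sum => d _.
  rewrite nu_normZ /= expr0n addr0 sqrtr_sqr ger0_norm//.
  by rewrite ler_wpM2l.
rewrite -[mxmean F](subrK (mxmean G)) addrC.
apply: le_trans (nu_normD _ _) (lerD Gb _).
rewrite -mxmeanB//; apply: cE => i j; rewrite mxE.
have FG x : normc ((F x - G x) i j) <= e / 2.
  by rewrite mxE [(- G x) i j]mxE; apply: qP; rewrite (repP _ x).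
apply: le_trans (normc_le_ReIm _) _; rewrite [e]splitr /=.
apply: lerD; apply: (mean_le x0 m_le) => x.
  exact: le_trans (Re_le_normc _) (FG x).
exact: le_trans (Im_le_normc _) (FG x).
Qed.

End MatrixMean.

(** * Averaging a unitary cocycle *)

Section Averaging.
Variables (R : realType) (X : Type) (x0 : X).
Variable m : {linear linfty R X -> R^o}.
Hypothesis m1 : m (linfty_one R X) = 1.
Hypothesis m_le : forall f, `|m f| <= linfty_norm f.
Variables (U : normed_unitary R) (G : groupType) (act : G -> X -> X).
Hypothesis m_act : forall g f, m (linfty_comp f (act g)) = m f.
Local Notation C := R[i].
Local Notation k := (nu_dim U).
Local Notation N := (@nu_norm R U).
Variable F : G -> X -> 'M[C]_k.
Hypothesis F_unitary : forall g x, F g x \is unitarymx.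
Hypothesis F1 : forall x, F 1%g x = 1%:M.
Hypothesis FM : forall g h x, F (g * h)%g x = F g (act h x) *m F h x.
Variables (f : G -> 'M[C]_k) (e : R).
Hypothesis F_near : forall g x, N (F g x - f g) <= e.

Let T g := mxmean m (F g).
Let bF g : nbounded (F g) := nbounded_unitary (F_unitary g).

(** The cocycle identity for [g^-1] and [g] shows that [F g^-1 (act g x)] is the adjoint of [F g x];
    invariance of the mean removes the shift by [g]. *)
Lemma average_adj g : T g^-1%g = (T g)^t*.
Proof.
rewrite /T -mxmean_adj// -(mxmean_comp (m_act g) (bF g^-1%g)).
congr mxmean; apply/funext => x.
have := FM g^-1%g g x; rewrite mulVg F1 => /(congr1 (fun A => A *m (F g x)^t*)).
by rewrite mul1mx -mulmxA (unitarymxP (F_unitary g x)) mulmx1.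
Qed.

Lemma average_near g : N (T g - f g) <= e.
Proof.
rewrite -[f g](mxmean_cst m1) -mxmeanB//; last exact: nbounded_cst.
exact: (mxmean_norm x0 m1 m_le).
Qed.

(** [T g] is an average of unitaries. Submultiplicativity alone would only give the factor [N 1%:M],
    which is not bounded uniformly over the family. *)
Lemma average_contract g A : N (T g *m A) <= N A.
Proof.
rewrite -mxmeanMr//; apply: (mxmean_norm x0 m1 m_le) => x.
by rewrite nu_norm_unitaryl.
Qed.

(* The error is the mean of the product of two deviations from the mean, hence
   quadratic in the defect (Kazhdan). *)
Lemma average_mul g h : N (T (g * h)%g - T g *m T h) <= 4 * e ^+ 2.
Proof.
have bs : nbounded (fun x => F g (act h x)).
  exact: nbounded_unitary (fun x => F_unitary g (act h x)).
have bgh : nbounded (fun x => F g (act h x) *m F h x).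
  by apply: nbounded_unitary => x; exact: mul_unitarymx.
have bB A (E : X -> 'M[C]_k) : nbounded E -> nbounded (fun x => E x - A).
  by move=> bE; apply: nboundedD => //; exact: nbounded_cst.
have b1 : nbounded (fun x => F g (act h x) *m T h - T g *m T h).
  by apply/bB/nboundedMr.
have -> : T (g * h)%g - T g *m T h =
    mxmean m (fun x => (F g (act h x) - T g) *m (F h x - T h)).
  transitivity (mxmean m (fun x =>
    (F g (act h x) *m F h x - T g *m F h x)
    - (F g (act h x) *m T h - T g *m T h))); last first.
    by congr mxmean; apply/funext => x; rewrite mulmxBr !mulmxBl.
  rewrite mxmeanB//; last first.
    by apply: nboundedD => //; exists (N (T g) * N 1%:M) => x; rewrite nu_normN;
      apply: le_trans (nu_normM _ _) _; rewrite -[F h x]mulmx1 nu_norm_unitaryl.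
  rewrite !mxmeanB//; [|exact: nboundedMr|exact: nbounded_cst|exact: nboundedMl].
  (* By invariance [F g (act h x)] has mean [T g], so the second bracket has mean zero. *)
  rewrite mxmeanMl// mxmeanMr// mxmean_cst// (mxmean_comp (m_act h) (bF g)).
  rewrite subrr subr0; congr (mxmean _ _ - _).
  by apply/funext => x.
apply: (mxmean_norm x0 m1 m_le) => x; apply: le_trans (nu_normM _ _) _.
have near2 g' y : N (F g' y - T g') <= 2 * e.
  rewrite mulr_natl mulr2n; apply: le_trans (nu_dist_tri (f g') _ _) _.
  by rewrite lerD// nu_distC average_near.
have -> : 4 * e ^+ 2 = (2 * e) * (2 * e) by ring.
by apply: ler_pM; rewrite ?nu_norm_ge0.
Qed.

(** As [T 1 = 1] and [T g^-1] is the adjoint of [T g], the quadratic estimate for [g] and [g^-1]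
    says that [T g] is nearly unitary; [u g] is then its polar part. *)
Lemma average_unitary : 4 * e ^+ 2 < 1 -> exists u : G -> 'M[C]_k,
  [/\ forall g, u g \is unitarymx,
      forall g, N (u g - f g) <= e + 4 * e ^+ 2 &
      forall g h, N (u (g * h)%g - u g *m u h) <= 16 * e ^+ 2].
Proof.
move=> e1.
have T1 g : N (T g *m (T g)^t* - 1%:M) <= 4 * e ^+ 2.
  have := average_mul g g^-1%g; rewrite mulgV average_adj nu_distC.
  suff -> : T 1%g = 1%:M by [].
  by rewrite -[RHS](mxmean_cst m1); congr mxmean; apply/funext => x.
have /choice[u uP] g : exists u, u \is unitarymx /\ N (u - T g) <= 4 * e ^+ 2.
  have [u uu uT] := polar_close (le_lt_trans (T1 g) e1).
  by exists u; split=> //; exact: le_trans uT (T1 g).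
have uT g : N (u g - T g) <= 4 * e ^+ 2 by have [] := uP g.
have uu g : u g \is unitarymx by have [] := uP g.
exists u; split=> // [g|g h].
  apply: le_trans (nu_dist_tri (T g) _ _) _.
  by rewrite addrC lerD// average_near.
apply: le_trans (nu_dist_tri (T (g * h)%g) _ _) _.
(* Four errors: replacing [u (g h)] by [T (g h)], the multiplicativity of [T], and replacing [T h]
   and [T g] by [u h] and [u g]. *)
have -> : 16 * e ^+ 2 = 4 * e ^+ 2 + (4 * e ^+ 2 + (4 * e ^+ 2 + 4 * e ^+ 2)) by ring.
apply: lerD => //; apply: le_trans (nu_dist_tri (T g *m T h) _ _) _.
apply: lerD; first exact: average_mul.
apply: le_trans (nu_dist_tri (T g *m u h) _ _) _; apply: lerD.
  by rewrite -mulmxBr; apply: le_trans (average_contract _ _) _; rewrite nu_distC.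
by rewrite -mulmxBl nu_norm_unitaryr// nu_distC.
Qed.

End Averaging.

(** * Correction along a coamenable subgroup *)

Section Cosets.
Variables (G : groupType) (H : groupClosed G).

Definition coset_repr (g : G) : G := repr (\pi_(lcosets H) g).

Fact coset_part_subproof (g : G) : ((coset_repr g)^-1 * g)%g \in H.
Proof. by have /eqmodP := reprK (\pi_(lcosets H) g). Qed.

Definition coset_part (g : G) : subgroup H :=
  @exist _ (fun x => x \in H) _ (coset_part_subproof g).

Lemma coset_reprK (g : G) : (coset_repr g * val (coset_part g))%g = g.
Proof. by rewrite SubK mulVKg. Qed.

Lemma coset_reprM (g : G) (l : subgroup H) :
  coset_repr (g * val l)%g = coset_repr g.
Proof.
congr repr; apply/eqmodP; rewrite /= /lcoset_rel invgM -mulgA mulVg mulg1.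
by rewrite gpredV; exact: (valP l).
Qed.

Lemma coset_partM (g : G) (l : subgroup H) :
  coset_part (g * val l)%g = (coset_part g * l)%g.
Proof. by apply: val_inj; rewrite valM !SubK coset_reprM mulgA. Qed.

(** Choosing representatives commutes with the action only up to a right factor in [H], which
    functions constant on left cosets do not see. *)
Lemma lcoset_act_repr (g x : G) : exists l : subgroup H,
  repr (lcoset_act g (\pi_(lcosets H) x)) = (g * x * val l)%g.
Proof.
rewrite lcoset_actE; exists (coset_part (g * x)%g)^-1%g.
by rewrite gmulfV -{2}[(g * x)%g]coset_reprK mulgK.
Qed.

End Cosets.

(** * One correction step, halving the defect *)

Section Correction.
Variables (R : realType) (G : groupType) (H : groupClosed G).
Variable U : normed_unitary R.
Local Notation N := (@nu_norm R U).
Local Notation unitary := (unitary R (nu_dim U)).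

(** Pointwise bounds replace the suprema [defect] and [udist] throughout the estimates. *)
Definition almost_hom (K : groupType) (phi : K -> unitary) (e : R) :=
  forall g h, N (val (phi (g * h)%g) - val (phi g) *m val (phi h)) <= e.

Definition uclose (K : Type) (phi psi : K -> unitary) (e : R) :=
  forall g, N (val (phi g) - val (psi g)) <= e.

Lemma val_unitaryM (u v : unitary) : val (u * v)%g = val u *m val v.
Proof. by []. Qed.

(** Put [L = 3 + 2 * c]. The averaged cocycle lies within [L e] of [phi], so the new defect is at
    most [16 (L e)^2], and the smallness condition on [e] is exactly what bounds this by [e / 2]. *)
Lemma coamenable_correction (phi : G -> unitary)
    (psi : {multiplicative subgroup H -> unitary}) (c e : R) :
  coamenable R H -> 0 <= c -> 32 * (3 + 2 * c) ^+ 2 * e <= 1 ->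
  almost_hom phi e -> uclose (phi \o val) psi (c * e) ->
  exists2 phi' : G -> unitary,
    almost_hom phi' (e / 2) & uclose phi' phi (2 * (3 + 2 * c) * e).
Proof.
move=> [m [m1 m_le m_act]] c0 e_small phi_hom phi_psi.
have e0 : 0 <= e by exact: le_trans (nu_norm_ge0 _) (phi_hom 1%g 1%g).
pose phi1 g := (phi (coset_repr H g) * psi (coset_part H g))%g.
have phi1M g l : phi1 (g * val l)%g = (phi1 g * psi l)%g.
  by rewrite /phi1 coset_reprM coset_partM gmulfM mulgA.
have phi1_near : uclose phi1 phi ((1 + c) * e).
  move=> g; rewrite nu_distC -{1}[g](coset_reprK H) mulrDl mul1r.
  apply: le_trans (nu_dist_tri _ _ _) (lerD (phi_hom _ _) _).
  by rewrite val_unitaryM -mulmxBr nu_norm_unitaryl ?(valP (phi _))//; exact: phi_psi.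
pose q g x := (phi1 (g * x)%g * (phi1 x)^-1)%g.
(* The two factors [psi l] cancel, so [q g] descends to the left cosets. *)
have qM g x (l : subgroup H) : q g (x * val l)%g = q g x.
  rewrite /q mulgA (phi1M (g * x)%g) (phi1M x); exact: mulgKA.
pose F g (y : lcosets H) := val (q g (repr y)).
have FM g h y : F (g * h)%g y = F g (lcoset_act h y) *m F h y.
  rewrite -val_unitaryM; congr val; rewrite -[in lcoset_act _ _](reprK y).
  have [l ->] := lcoset_act_repr H h (repr y).
  by rewrite qM /q -[in RHS]mulgA mulKg mulgA.
have F1 y : F 1%g y = 1%:M by rewrite /F /q mul1g mulgV.
have F_near g y : N (F g y - val (phi g)) <= (3 + 2 * c) * e.
  set x := repr y.
  (* Multiplying by the unitary [phi1 x] turns the quotient into a near-multiplicativity estimate: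
     two replacements of [phi1] by [phi], each costing [(1 + c) e], and one defect [e]. *)
  have -> : N (F g y - val (phi g)) =
      N (val (phi1 (g * x)%g) - val (phi g) *m val (phi1 x)).
    rewrite -(nu_norm_unitaryr (F g y - _) (valP (phi1 x))) mulmxBl.
    have -> // : F g y *m val (phi1 x) = val (phi1 (g * x)%g).
    by rewrite -val_unitaryM mulgVK.
  apply: le_trans (nu_dist_tri (val (phi (g * x)%g)) _ _) _.
  have -> : (3 + 2 * c) * e = (1 + c) * e + (e + (1 + c) * e) by ring.
  apply: lerD; first exact: phi1_near.
  apply: le_trans (nu_dist_tri (val (phi g) *m val (phi x)) _ _) _.
  apply: lerD; first exact: phi_hom.
  by rewrite -mulmxBr nu_norm_unitaryl ?(valP (phi _))// nu_distC; exact: phi1_near.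
have m_act' g f : m (linfty_comp f (lcoset_act g)) = m f.
  by have := m_act g^-1%g f; rewrite /linfty_act invgK.
set L := 3 + 2 * c in e_small F_near *.
have L3 : 3 <= L by rewrite /L lerDl mulr_ge0.
have Le0 : 0 <= L * e by rewrite mulr_ge0// (le_trans _ L3).
(* This makes [4 (L e)^2] smaller than 1, as averaging requires, and at most [L e], whence the final
   distance [2 L e]. *)
have Le4 : 4 * (L * e) <= 1 by nra.
have [|u [uu u_near u_hom]] := @average_unitary _ _ (\pi_(lcosets H) 1%g) m m1
  m_le U G (@lcoset_act _ _) m_act' F (fun g y => valP (q g (repr y))) F1 FM
  (fun g => val (phi g)) (L * e) F_near.
  by nra.
exists (fun g => Sub (u g) (uu g)) => [g h|g]; rewrite !SubK.
  by apply: le_trans (u_hom g h) _; nra.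
by apply: le_trans (u_near g) _; nra.
Qed.

End Correction.

(** * Limits *)

Section GeometricLimits.
Variable R : realType.
Local Notation C := R[i].

Lemma geometric_small (a e : R) : 0 < e -> exists n, a / 2 ^+ n <= e.
Proof.
move=> e0; have [a0|a0] := leP a 0.
  by exists 0; rewrite expr0 divr1 (le_trans a0)// ltW.
exists (Num.truncn (a / e)).+1; rewrite ler_pdivrMr ?exprn_gt0//.
rewrite mulrC -ler_pdivrMr//; apply: ltW; apply: lt_le_trans (truncnS_gt _) _.
by rewrite -natrX ler_nat ltnW// ltn_expl.
Qed.

Lemma le_geometric (x y a : R) : (forall n, x <= y + a / 2 ^+ n) -> x <= y.
Proof.
move=> xy; apply/ler_addgt0Pr => e e0; have [n an] := geometric_small a e0.
by apply: le_trans (xy n) _; rewrite lerD2l.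
Qed.

(** The radius [r n] is the sum of all step bounds from [n] on, so the intervals of radius [r n]
    around [x n] are nested. The supremum of their left endpoints lies in all of them. *)
Lemma geometric_limit (x : nat -> R) (b : R) :
  (forall n, `|x n.+1 - x n| <= b / 2 ^+ n) ->
  exists y, forall n, `|x n - y| <= 2 * b / 2 ^+ n.
Proof.
move=> xb; pose r n := 2 * b / 2 ^+ n : R.
have rS n : r n - r n.+1 = b / 2 ^+ n.
  by rewrite /r exprS; field; rewrite expf_neq0.
have lo i j : (i <= j)%N -> x i - r i <= x j - r j.
  move=> /subnK <-; elim: (j - i)%N => [|d IH]; first by rewrite add0n.
  apply: le_trans IH _; have := xb (d + i)%N; rewrite addSn -rS.
  by rewrite ler_norml => /andP[]; lra.
have hi i j : (i <= j)%N -> x j + r j <= x i + r i.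
  move=> /subnK <-; elim: (j - i)%N => [|d IH]; first by rewrite add0n.
  apply: le_trans _ IH; have := xb (d + i)%N; rewrite addSn -rS.
  by rewrite ler_norml => /andP[]; lra.
have r0 n : 0 <= r n.
  have b0 : 0 <= b by have := xb 0%N; rewrite expr0 divr1; apply: le_trans.
  by rewrite /r divr_ge0 ?mulr_ge0// exprn_ge0.
have lohi i j : x i - r i <= x j + r j.
  have [ij|/ltnW ji] := leqP i j.
    by apply: le_trans (lo _ _ ij) _; have := r0 j; lra.
  by apply: le_trans _ (hi _ _ ji); have := r0 i; lra.
exists (sup (range (fun n => x n - r n))) => n.
rewrite ler_distlC; apply/andP; split.
  apply: ub_le_sup; last by exists n.
  by exists (x 0%N + r 0%N) => _ [i _ <-].
by apply: ge_sup => [|_ [i _ <-]//]; exists (x 0%N - r 0%N), 0%N.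
Qed.

Lemma geometric_climit (z : nat -> C) (b : R) :
  (forall n, normc (z n.+1 - z n) <= b / 2 ^+ n) ->
  exists w, forall n, normc (z n - w) <= 4 * b / 2 ^+ n.
Proof.
move=> zb.
have [|p pP] := @geometric_limit (fun n => complex.Re (z n)) b.
  move=> n; apply: le_trans (zb n); apply: le_trans (Re_le_normc _).
  by case: (z n) (z n.+1) => [? ?] [? ?].
have [|q qP] := @geometric_limit (fun n => complex.Im (z n)) b.
  move=> n; apply: le_trans (zb n); apply: le_trans (Im_le_normc _).
  by case: (z n) (z n.+1) => [? ?] [? ?].
exists (p +i* q)%C => n; apply: le_trans (normc_le_ReIm _) _.
have -> : 4 * b / 2 ^+ n = 2 * b / 2 ^+ n + 2 * b / 2 ^+ n by ring.
by move: (pP n) (qP n); case: (z n) => u v /= pu qv; exact: lerD.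
Qed.

(** * Limits of unitary matrices and of almost homomorphisms *)

Variable U : normed_unitary R.
Local Notation k := (nu_dim U).
Local Notation N := (@nu_norm R U).

Lemma normc_conj (z : C) : normc z^* = normc z.
Proof. by case: z => a b; rewrite /= sqrrN. Qed.

(** Entrywise convergence produces [v], with a rate [B] depending on the norm. The rate [2 * a]
    comes from summing the steps up to a far index and letting that index tend to infinity. *)
Lemma unitary_limit (u : nat -> 'M[C]_k) (a : R) :
  (forall n, u n \is unitarymx) ->
  (forall n, N (u n.+1 - u n) <= a / 2 ^+ n) ->
  exists2 v, v \is unitarymx & forall n, N (u n - v) <= 2 * a / 2 ^+ n.
Proof.
move=> uu ua; have [c c0 cE] := nu_norm_entry U.
have [c' c'0 c'E] := nu_norm_le_entries U.
have /choice[w wP] (ij : 'I_k * 'I_k) : exists w, forall n,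
    normc (u n ij.1 ij.2 - w) <= 4 * (c * a) / 2 ^+ n.
  apply: geometric_climit => n; have := cE (u n.+1 - u n) ij.1 ij.2.
  by rewrite !mxE -mulrA => /le_trans; apply; exact: ler_wpM2l.
pose v := \matrix_(i, j) w (i, j).
pose B := c' * (4 * (c * a)).
have uv n : N (u n - v) <= B / 2 ^+ n.
  rewrite /B -mulrA; apply: c'E => i j.
  by rewrite !mxE; exact: (wP (i, j)).
have uv' n : N ((v - u n)^t*) <= B / 2 ^+ n.
  rewrite /B -mulrA; apply: c'E => i j.
  rewrite !mxE [normc _]normc_conj -normcN opprB; exact: (wP (j, i)).
exists v.
  (* The difference of [v v^*] and [u_n u_n^*] is split through [u_n v^*]; both parts decay
     geometrically. *)
  apply/unitarymxP/eqP; rewrite -subr_eq0; apply/eqP/nu_norm_eq0/le_anti.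
  rewrite nu_norm_ge0 andbT; apply: (@le_geometric _ _ (B * N (v^t*) + B)) => n.
  rewrite add0r -(unitarymxP (uu n)).
  apply: le_trans (nu_dist_tri (u n *m v^t*) _ _) _; rewrite mulrDl; apply: lerD.
    rewrite -mulmxBl; apply: le_trans (nu_normM _ _) _.
    by rewrite mulrAC ler_wpM2r ?nu_norm_ge0// nu_distC.
  rewrite -mulmxBr nu_norm_unitaryl//.
  by have <- : (v - u n)^t* = v^t* - (u n)^t* by rewrite raddfB map_mxB.
move=> n; apply: (@le_geometric _ _ B) => i.
have un d : N (u n - u (d + n)%N) <= 2 * a / 2 ^+ n - 2 * a / 2 ^+ (d + n).
  elim: d => [|d IH]; first by rewrite add0n !subrr nu_norm0.
  apply: le_trans (nu_dist_tri (u (d + n)%N) _ _) _.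
  have := ua (d + n)%N; rewrite nu_distC => /(lerD IH)/le_trans; apply.
  rewrite addSn exprS -addrA lerD2l le_eqVlt; apply/orP; left; apply/eqP.
  by field; rewrite expf_neq0.
have a0 : 0 <= a.
  by have := ua 0%N; rewrite expr0 divr1; apply: le_trans; exact: nu_norm_ge0.
have B0 : 0 <= B by rewrite !mulr_ge0.
apply: le_trans (nu_dist_tri (u (i + n)%N) _ _) _; apply: lerD.
  apply: le_trans (un i) _.
  by rewrite lerBlDr lerDl divr_ge0 ?mulr_ge0// exprn_ge0.
apply: le_trans (uv _) _; rewrite ler_wpM2l// lef_pV2 ?posrE ?exprn_gt0//.
by rewrite ler_weXn2l ?ler1n// leq_addr.
Qed.

Variable G : groupType.
Local Notation unitary := (unitary R k).

(** The successive corrections have size at most [K e / 2^n], with sum [2 K e]; the defects tend to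
    0, so the limit is multiplicative. *)
Lemma hom_of_defect_halving (d K : R) : 0 <= K ->
  (forall (phi : G -> unitary) (e : R), e <= d -> almost_hom phi e ->
    exists2 phi' : G -> unitary, almost_hom phi' (e / 2) & uclose phi' phi (K * e)) ->
  forall (phi : G -> unitary) (e : R), e <= d -> almost_hom phi e ->
    exists psi : {multiplicative G -> unitary}, uclose phi psi (2 * K * e).
Proof.
move=> K0 halve phi e ed phi_hom.
have e0 : 0 <= e by exact: le_trans (nu_norm_ge0 _) (phi_hom 1%g 1%g).
have e2 n : 0 <= e / 2 ^+ n by rewrite divr_ge0// exprn_ge0.
(* A total function is chosen, with default value [phi] off the almost homomorphisms, so that it can
   be iterated without carrying proofs. *)
have /choice[next nextP] (nf : nat * (G -> unitary)) : exists f : G -> unitary,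
    almost_hom nf.2 (e / 2 ^+ nf.1) ->
    almost_hom f (e / 2 ^+ nf.1.+1) /\ uclose f nf.2 (K * (e / 2 ^+ nf.1)).
  have [h|nh] := pselect (almost_hom nf.2 (e / 2 ^+ nf.1)); last by exists phi.
  have [|f fh fc] := halve _ _ _ h.
    by apply: le_trans ed; rewrite ler_pdivrMr ?exprn_gt0// ler_peMr// exprn_ege1// ler1n.
  by exists f => _; split=> //; rewrite exprSr invfM mulrA.
pose f := fix f n := if n is n'.+1 then next (n', f n') else phi.
have f_hom n : almost_hom (f n) (e / 2 ^+ n).
  elim: n => [|n IH]; first by rewrite expr0 divr1.
  by have [] := nextP (n, f n) IH.
have f_close n : uclose (f n.+1) (f n) (K * (e / 2 ^+ n)).
  by have [] := nextP (n, f n) (f_hom n).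
have /choice[v vP] g : exists v : unitary,
    forall n, N (val (f n g) - val v) <= 2 * (K * e) / 2 ^+ n.
  have [||v uv vP] := @unitary_limit (fun n => val (f n g)) (K * e).
  - by move=> n; exact: valP.
  - by move=> n; rewrite -mulrA; exact: f_close.
  - by exists (Sub v uv) => n; rewrite SubK.
have vM : {morph v : g h / (g * h)%g >-> (g * h)%g}.
  move=> g h; apply/val_inj/eqP; rewrite -subr_eq0; apply/eqP/nu_norm_eq0/le_anti.
  rewrite nu_norm_ge0 andbT.
  (* One [a] for the value at the product, [e] for the defect of [f n], and one [a] for each of the
     two factors. *)
  pose a := 2 * (K * e); apply: (@le_geometric _ _ (a + (e + (a + a)))) => n.
  rewrite add0r !mulrDl; apply: le_trans (nu_dist_tri (val (f n (g * h)%g)) _ _) _.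
  apply: lerD; first by rewrite nu_distC.
  apply: le_trans (nu_dist_tri (val (f n g) *m val (f n h)) _ _) _.
  apply: lerD; first exact: f_hom.
  apply: le_trans (nu_dist_tri (val (v g) *m val (f n h)) _ _) _.
  apply: lerD; first by rewrite -mulmxBl nu_norm_unitaryr ?(valP (f n h)).
  by rewrite val_unitaryM -mulmxBr nu_norm_unitaryl ?(valP (v g)).
pose vm := isMultiplicative.Build G unitary v vM.
exists (HB.pack v vm : {multiplicative G -> unitary}) => g.
by have := vP g 0%N; rewrite expr0 divr1 mulrA.
Qed.

End GeometricLimits.

(** * Stability *)

Section DefectSup.
Variables (R : realType) (G : groupType) (U : normed_unitary R).
Local Notation N := (@nu_norm R U).
Local Notation unitary := (unitary R (nu_dim U)).
Implicit Types phi psi : G -> unitary.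

Lemma nu_norm_unitary_le (u : unitary) : N (val u) <= N 1%:M.
Proof. by rewrite -[val u]mulmx1 nu_norm_unitaryl ?(valP u). Qed.

Lemma defect_almost_hom phi : almost_hom phi (defect phi).
Proof.
move=> g h; apply: ub_le_sup; last by exists (g, h).
exists (N 1%:M + N 1%:M) => _ [[a b] _ <-] /=.
apply: le_trans (nu_normB _ _) _; apply: lerD; first exact: nu_norm_unitary_le.
by rewrite -val_unitaryM; exact: nu_norm_unitary_le.
Qed.

Lemma defect_le phi e : almost_hom phi e -> defect phi <= e.
Proof.
move=> he; apply: ge_sup => [|_ [[a b] _ <-]]; last exact: he.
by eexists; exists (1%g, 1%g).
Qed.

Lemma defect_ge0 phi : 0 <= defect phi.
Proof. exact: le_trans (nu_norm_ge0 _) (defect_almost_hom phi 1%g 1%g). Qed.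

Lemma udist_uclose phi psi : uclose phi psi (udist phi psi).
Proof.
move=> g; apply: ub_le_sup; last by exists g.
exists (N 1%:M + N 1%:M) => _ [a _ <-] /=.
by apply: le_trans (nu_normB _ _) _; apply: lerD; exact: nu_norm_unitary_le.
Qed.

Lemma udist_le phi psi e : uclose phi psi e -> udist phi psi <= e.
Proof.
move=> he; apply: ge_sup => [|_ [a _ <-]]; last exact: he.
by eexists; exists 1%g.
Qed.

End DefectSup.

(** A tail loses one point at a time, and the complement of each point belongs to [omega]. *)
Lemma nonprincipal_tail (omega : set_system nat) : UltraFilter omega ->
  (forall n, omega <> principal_filter n) ->
  forall n, omega [set i | (n <= i)%N].
Proof.
move=> ultra np; elim=> [|n IH]; first exact: filterS filterT.
have [on|on] := in_ultra_setVsetC [set n] ultra.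
  (* If [[set n]] were in [omega], every member of [omega] would contain [n], and maximality would
     make [omega] principal. *)
  case: (np n); apply/esym/max_filter; first exact: principal_filter_proper.
  move=> A oA.
  have [i [Ai /= in_]] := filter_ex (filterI oA on).
  by apply/principal_filterP; rewrite -in_.
apply: filterS (filterI IH on) => i [/= ni in_]; rewrite ltn_neqAle ni andbT.
by apply/eqP => ni'; apply: in_.
Qed.

(* A sequence of counterexamples with constants n would contradict the stability of
   the sequence, because every member of omega is unbounded. *)
Lemma stable_linear_uniform (R : realType) (G : groupType)
    (UU : set (normed_unitary R)) (omega : set_system nat) : UltraFilter omega ->
  (forall n, omega <> principal_filter n) ->
  uniformly_stable_linear G UU omega ->
  exists n : nat, forall (U : normed_unitary R) (phi : G -> unitary R (nu_dim U)),
    UU U -> defect phi <= n.+1%:R^-1 ->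
    exists psi : {multiplicative G -> unitary R (nu_dim U)},
      udist phi psi <= n%:R * defect phi.
Proof.
move=> ultra np stable; apply: contrapT => none.
have /choice[s sP] (n : nat) : exists s : {U & G -> unitary R (nu_dim U)},
    [/\ UU (tag s), defect (tagged s) <= n.+1%:R^-1 &
    forall psi : {multiplicative G -> unitary R (nu_dim (tag s))},
      n%:R * defect (tagged s) < udist (tagged s) psi].
  apply: contrapT => nos; apply: none; exists n => U phi UUU def.
  apply: contrapT => nopsi; apply: nos; exists (Tagged _ phi); split=> // psi.
  by rewrite ltNge; apply/negP => le; apply: nopsi; exists psi.
have [|psi [C C0 [S oS CS]]] := stable (fun n => tag (s n)) (fun n => tagged (s n)).
  split=> [n|]; first by have [] := sP n.
  apply: (@squeeze_cvgr _ _ _ _ (fun=> 0) harmonic); last exact: cvg_harmonic.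
    by apply: nearW => n; have [_ ? _] := sP n; rewrite defect_ge0.
  exact: cvg_cst.
(* An index in [S] beyond [C]: there the bound with constant [C] contradicts the choice of [s n]. *)
have [n [Sn Cn]] := filter_ex (filterI oS (nonprincipal_tail ultra np (Num.truncn C).+1)).
have [_ _ /(_ (psi n))] := sP n; apply/negP; rewrite -leNgt.
apply: le_trans (CS n Sn) _; rewrite ler_wpM2r ?defect_ge0//.
by apply: ltW; apply: lt_le_trans (truncnS_gt C) _; rewrite ler_nat.
Qed.

Theorem proposition1p5 (R : realType)
  (omega : set_system nat) (omega_ultra : UltraFilter omega)
  (omega_nonprincipal : forall n : nat, omega <> principal_filter n)
  (UU : set (normed_unitary R))
  (Gamma : groupType) (Gamma_countable : countable [set: Gamma]%classic)
  (Lambda : groupClosed Gamma) :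
  coamenable R Lambda ->
  uniformly_stable_linear (subgroup Lambda) UU omega ->
  uniformly_stable_linear Gamma UU omega.
Proof.
move=> coam /(stable_linear_uniform omega_ultra omega_nonprincipal)[n nP].
move=> U phi [UUn phi0].
pose L : R := 3 + 2 * n%:R; pose K := 2 * L.
have L0 : 0 < L by rewrite ltr_pwDl// mulr_ge0.
have L2 : 0 < 32 * L ^+ 2 by rewrite mulr_gt0// exprn_gt0.
(* The first bound lets the uniform form of stability apply to the restriction to [Lambda]; the
   second is the smallness needed for one correction step. *)
pose d := Num.min (n.+1%:R^-1) (32 * L ^+ 2)^-1 : R.
have d0 : 0 < d by rewrite lt_min !invr_gt0 L2 ltr0n.
have K0 : 0 <= K by rewrite mulr_ge0// ltW.
have stable i : exists psi : {multiplicative Gamma -> unitary R (nu_dim (U i))},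
    defect (phi i) <= d -> uclose (phi i) psi (2 * K * defect (phi i)).
  have [di|nd] := pselect (defect (phi i) <= d); last first.
    (* The trivial homomorphism is a default value for indices with large defect, which are left out
       of the set chosen in [omega]. *)
    by exists [the {multiplicative _ -> _} of @one_fun _ _].
  have [|psi psiP] := @hom_of_defect_halving R (U i) Gamma d K K0 _ (phi i) _ di
    (defect_almost_hom _); last by exists psi.
  move=> f e; rewrite /d le_min => /andP[en eL] f_hom.
  have fv_hom : almost_hom (f \o val : subgroup Lambda -> _) e.
    by move=> g h; exact: (f_hom (val g) (val h)).
  have fv_defect := defect_le fv_hom.
  have [psi psiP] := nP _ _ (UUn i) (le_trans fv_defect en).
  (* Here [c] is [n%:R], so [K] depends on neither the dimension nor the norm. *)
  apply: (coamenable_correction (psi := psi) coam) => //.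
    by rewrite -ler_pdivlMl// mulr1.
  move=> g; apply: le_trans (udist_uclose _ _ _) _; apply: le_trans psiP _.
  exact: ler_wpM2l.
exists (fun i => projT1 (cid (stable i))); exists (2 * K); first by rewrite mulr_ge0.
exists [set i | defect (phi i) <= d]; last first.
  by move=> i di; apply: udist_le; exact: (projT2 (cid (stable i))).
have [N _ Nd] : \forall i \near \oo, defect (phi i) <= d.
  have := cvgr_le (0 : R) phi0; apply.
  exact: d0.
by apply: filterS (nonprincipal_tail omega_ultra omega_nonprincipal N) => i; exact: Nd.
Qed.
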